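(* For every $\alpha>-1$ the half-range system with parameter $\alpha$ coincides with the full-range system with parameters $(\alpha,\alpha)$: for all $m\in\mathbb{Z}_+$ and $x\in\mathbb{R}$, $\varphi_m^{\alpha}(x)=\varphi_m^{(\alpha,\alpha)}(x)$.
   Context: $\mathbb{Z}_+=\{0,1,2,\ldots\}$. $P_m^{(\alpha,\beta)}$ is the $m$th Jacobi polynomial in the standard normalisation, and $g_m^{(\alpha,\beta)}=\int_{-1}^1(1-t)^\alpha(1+t)^\beta[P_m^{(\alpha,\beta)}(t)]^2\,dt$. The full-range system (tanh-Jacobi functions) is, for $\alpha,\beta>-1$, $$\varphi_m^{(\alpha,\beta)}(x)=\frac{(-1)^m}{\sqrt{g_m^{(\alpha,\beta)}}}(1-\tanh x)^{\frac{\alpha+1}{2}}(1+\tanh x)^{\frac{\beta+1}{2}}P_m^{(\alpha,\beta)}(\tanh x),\qquad m\in\mathbb{Z}_+ .$$ The half-range system is, for $\alpha>-1$ and $m\in\mathbb{Z}_+$, $$\varphi^{\alpha}_{2m}(x)=\frac{2^{(2\alpha+1)/4}}{\sqrt{g_m^{(\alpha,-\frac12)}}}\,\frac{1}{\cosh^{1+\alpha}x}\,P_m^{(\alpha,-\frac12)}\!\left(1-\frac{2}{\cosh^2x}\right),$$ $$\varphi^{\alpha}_{2m+1}(x)=-\frac{2^{(2\alpha+3)/4}}{\sqrt{g_m^{(\alpha,\frac12)}}}\,\frac{\sinh x}{\cosh^{2+\alpha}x}\,P_m^{(\alpha,\frac12)}\!\left(1-\frac{2}{\cosh^2x}\right).$$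 *)

(* Defs.v *)
From Stdlib Require Import Arith Factorial Reals.
From Coquelicot Require Import Coquelicot.
Open Scope R_scope.

(** Rising factorial [a (a+1) ... (a+n-1)]. *)
Fixpoint pochhammer (a : R) (n : nat) : R :=
  match n with
  | O => 1
  | S k => pochhammer a k * (a + INR k)
  end.

(** Jacobi polynomial [P_m^(alpha,beta)(t)], normalised by
    [P_m^(alpha,beta)(1) = (alpha+1)_m / m!].  This is the terminating series
    [(alpha+1)_m / m! * 2F1(-m, m+alpha+beta+1; alpha+1; (1-t)/2)], with
    [(alpha+1)_m / (alpha+1)_k] written as [(alpha+k+1)_(m-k)]. *)
Definition jacobi (alpha beta : R) (m : nat) (t : R) : R :=
  sum_f_R0
    (fun k =>
       pochhammer (INR m + alpha + beta + 1) k
       * pochhammer (alpha + INR k + 1) (m - k)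
       / (INR (fact k) * INR (fact (m - k)))
       * ((t - 1) / 2) ^ k)
    m.

(** The integral is improper at both ends: the weight is unbounded at [1] when
    [alpha < 0] and at [-1] when [beta < 0].  It converges for
    [alpha, beta > -1]. *)
Definition jacobi_norm (alpha beta : R) (m : nat) : R :=
  RInt_gen
    (fun t => Rpower (1 - t) alpha * Rpower (1 + t) beta
              * jacobi alpha beta m t ^ 2)
    (at_right (-1)) (at_left 1).

Definition full_range (alpha beta : R) (m : nat) (x : R) : R :=
  (-1) ^ m / sqrt (jacobi_norm alpha beta m)
  * Rpower (1 - tanh x) ((alpha + 1) / 2)
  * Rpower (1 + tanh x) ((beta + 1) / 2)
  * jacobi alpha beta m (tanh x).

Definition half_range_even (alpha : R) (k : nat) (x : R) : R :=
  Rpower 2 ((2 * alpha + 1) / 4) / sqrt (jacobi_norm alpha (- (1 / 2)) k)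
  * (1 / Rpower (cosh x) (1 + alpha))
  * jacobi alpha (- (1 / 2)) k (1 - 2 / cosh x ^ 2).

Definition half_range_odd (alpha : R) (k : nat) (x : R) : R :=
  - (Rpower 2 ((2 * alpha + 3) / 4) / sqrt (jacobi_norm alpha (1 / 2) k))
  * (sinh x / Rpower (cosh x) (2 + alpha))
  * jacobi alpha (1 / 2) k (1 - 2 / cosh x ^ 2).

(** [Nat.div2 (2 * k) = Nat.div2 (2 * k + 1) = k]. *)
Definition half_range (alpha : R) (m : nat) (x : R) : R :=
  if Nat.even m then half_range_even alpha (Nat.div2 m) x
  else half_range_odd alpha (Nat.div2 m) x.

(* Main.v *)
Require Import Defs.
From Stdlib Require Import Factorial Classical Reals Lra Lia.
From Coquelicot Require Import Coquelicot.
Open Scope R_scope.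

(** The two systems agree because of the quadratic transformation of ultraspherical
    polynomials: for [e] equal to [0] or [1] there is a constant [c > 0] with
      [P_(2m+e)^(alpha,alpha)(t) = c t^e P_m^(alpha,e-1/2)(2 t^2 - 1)]
    ([jacobi_quadratic]).  At [t = tanh x] the argument on the right is
    [1 - 2 / cosh^2 x] and the weight is
    [((1 - t) (1 + t))^((alpha+1)/2) = cosh^(-1-alpha) x], so the two functions are
    proportional.  The factor is [1] because the substitution [s = 2 t^2 - 1] also turns
    one normalisation integral into the other, up to [c^2] and a power of two.  The parity
    [e] is kept as a parameter, so that both halves of the half-range system are treated
    at once.

    The transformation is proved on coefficients in the variable [u = (t - 1) / 2], in which
    [t = 1 + 2u] and [t^2 - 1 = 4u(1+u)].  The Jacobi equation becomes a two-term recurrence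
    for the coefficients of [P_(2m+e)^(alpha,alpha)] ([jacobi_coef_succ]), and
    [alpha > -1] makes its solution unique once the constant term is known.  The Jacobi
    operator maps [t^e (t^2-1)^j] to a combination of itself and [t^e (t^2-1)^(j-1)]
    ([even_coef_recurrence], [odd_coef_recurrence]); hence applying it to the right-hand
    side gives a sum that telescopes to zero ([quadratic_coef]).

    For the norms, let [F >= 0] be the integrand of the symmetric norm and [Phi] its
    primitive from [0].  [Phi] is increasing on [[0,1)] and, by comparison with
    [(1-t)^alpha], bounded; so it has a limit [L] at [1] ([jacobi_primitive_limit]).  As [F]
    is even, the symmetric norm is [2 L] ([jacobi_norm_symmetric]).  A multiple of
    [Phi(sqrt((1+s)/2))] is a primitive of the half-range integrand, vanishing at [s = -1], so
    the half-range norm is the same multiple of [L] ([jacobi_norm_half]). *)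

(** * Coefficients of Jacobi polynomials *)

Definition jacobi_coef (alpha beta : R) (m k : nat) : R :=
  pochhammer (INR m + alpha + beta + 1) k
  * pochhammer (alpha + INR k + 1) (m - k)
  / (INR (fact k) * INR (fact (m - k))).

Lemma pochhammer_head (a : R) (n : nat) :
  pochhammer a (S n) = a * pochhammer (a + 1) n.
Proof.
  induction n as [|n IH].
  - simpl. ring.
  - change (pochhammer a (S (S n))) with (pochhammer a (S n) * (a + INR (S n))).
    rewrite IH. cbn [pochhammer]. rewrite S_INR. ring.
Qed.

Lemma pochhammer_pos (a : R) (n : nat) : 0 < a -> 0 < pochhammer a n.
Proof.
  intros Ha. induction n as [|n IH]; simpl pochhammer.
  - lra.
  - apply Rmult_lt_0_compat; [exact IH | pose proof (pos_INR n); lra].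
Qed.

(** This is the Jacobi differential equation, read on the coefficients in
    [u = (t - 1) / 2]. *)
Lemma jacobi_coef_succ (alpha beta : R) (m k : nat) :
  (k < m)%nat ->
  (INR k + 1) * (INR k + alpha + 1) * jacobi_coef alpha beta m (S k)
  = (INR m - INR k) * (INR m + INR k + alpha + beta + 1)
    * jacobi_coef alpha beta m k.
Proof.
  intros Hk. destruct (Nat.le_exists_sub (S k) m Hk) as [d [-> _]].
  unfold jacobi_coef.
  replace (d + S k - S k)%nat with d by lia.
  replace (d + S k - k)%nat with (S d) by lia.
  rewrite (pochhammer_head (alpha + INR k + 1) d).
  replace (alpha + INR (S k) + 1) with (alpha + INR k + 1 + 1) by (rewrite S_INR; ring).
  cbn [pochhammer].
  rewrite !fact_simpl, !mult_INR, !plus_INR, !S_INR.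
  pose proof (INR_fact_neq_0 k). pose proof (INR_fact_neq_0 d).
  pose proof (pos_INR k). pose proof (pos_INR d).
  field. repeat split; try assumption; lra.
Qed.

Lemma jacobi_coef_0_pos (alpha beta : R) (m : nat) :
  -1 < alpha -> 0 < jacobi_coef alpha beta m 0.
Proof.
  intros Ha. unfold jacobi_coef. cbn [pochhammer]. rewrite Rmult_1_l.
  apply Rdiv_lt_0_compat.
  - apply pochhammer_pos. simpl. lra.
  - apply Rmult_lt_0_compat; apply INR_fact_lt_0.
Qed.

(** * Powers of t^2 - 1 in the variable u = (t - 1) / 2 *)

(** Multiplication by [u] on coefficient sequences. *)
Definition shift (a : nat -> R) (k : nat) : R :=
  match k with O => 0 | S i => a i end.

(** [even_coef j k] is the coefficient of [u^k] in [(4u(1+u))^j = (t^2-1)^j]. *)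
Fixpoint even_coef (j : nat) : nat -> R :=
  match j with
  | O => fun k => match k with O => 1 | S _ => 0 end
  | S i => fun k => 4 * (shift (even_coef i) k + shift (shift (even_coef i)) k)
  end.

(** [odd_coef j k] is the coefficient of [u^k] in [(1+2u)(4u(1+u))^j = t (t^2-1)^j]. *)
Definition odd_coef (j k : nat) : R :=
  even_coef j k + 2 * shift (even_coef j) k.

Lemma sum_shift (a : nat -> R) (u : R) (n : nat) :
  sum_f_R0 (fun k => shift a k * u ^ k) (S n)
  = u * sum_f_R0 (fun k => a k * u ^ k) n.
Proof.
  rewrite decomp_sum by lia. simpl pred. rewrite scal_sum.
  replace (shift a 0 * u ^ 0) with 0 by (simpl; ring). rewrite Rplus_0_l.
  apply sum_eq. intros i _. simpl. ring.
Qed.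

Lemma even_coef_sum (u : R) (j n : nat) :
  (2 * j <= n)%nat ->
  sum_f_R0 (fun k => even_coef j k * u ^ k) n = (4 * u * (1 + u)) ^ j.
Proof.
  revert n. induction j as [|j IH]; intros n Hn.
  - clear Hn. induction n as [|n IHn]; [simpl; ring|].
    rewrite tech5, IHn. simpl. ring.
  - destruct n as [|[|n]]; try lia.
    rewrite (sum_eq _ (fun k => 4 * (shift (even_coef j) k * u ^ k)
                 + 4 * (shift (shift (even_coef j)) k * u ^ k)))
      by (intros i _; cbn [even_coef]; ring).
    rewrite sum_plus.
    rewrite (sum_eq (fun k => 4 * (shift (even_coef j) k * u ^ k))
               (fun k => (shift (even_coef j) k * u ^ k) * 4)) by (intros; ring).
    rewrite (sum_eq (fun k => 4 * (shift (shift (even_coef j)) k * u ^ k))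
               (fun k => (shift (shift (even_coef j)) k * u ^ k) * 4)) by (intros; ring).
    rewrite <- !scal_sum, !sum_shift, !IH by lia. simpl. ring.
Qed.

Lemma odd_coef_sum (u : R) (j n : nat) :
  (2 * j + 1 <= n)%nat ->
  sum_f_R0 (fun k => odd_coef j k * u ^ k) n = (1 + 2 * u) * (4 * u * (1 + u)) ^ j.
Proof.
  intros Hn. destruct n as [|n]; [lia|].
  rewrite (sum_eq _ (fun k => even_coef j k * u ^ k
                 + shift (even_coef j) k * u ^ k * 2))
    by (intros i _; unfold odd_coef; ring).
  rewrite sum_plus, <- scal_sum, sum_shift, !even_coef_sum by lia. ring.
Qed.

(** With [w = 4u(1+u)] this is [u(1+u) (w^j)' = j (1+2u) w^j], compared coefficientwise. *)
Lemma even_coef_first_order (j k : nat) :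
  (INR k - INR j) * even_coef j k = (2 * INR j + 1 - INR k) * shift (even_coef j) k.
Proof.
  revert k. induction j as [|j IH]; intros k.
  - destruct k as [|[|k]]; simpl; ring.
  - destruct k as [|k]; [simpl; ring|].
    pose proof (IH k) as H1.
    assert (H2 : (INR k - 1 - INR j) * shift (even_coef j) k
                 = (2 * INR j + 2 - INR k) * shift (shift (even_coef j)) k).
    { destruct k as [|k]; [simpl; ring|].
      pose proof (IH k) as H. cbn [shift]. rewrite S_INR. lra. }
    rewrite !S_INR. cbn [even_coef shift]. lra.
Qed.

(** The operator [u(1+u) D^2 + (alpha+1)(1+2u) D - n(n+2alpha+1)] with [n = 2j] sends
    [w^j], where [w = 4u(1+u)], to [4j(j+alpha) w^(j-1)]. *)
Lemma even_coef_recurrence (alpha : R) (j k : nat) :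
  (INR k + 1) * (INR k + alpha + 1) * even_coef j (S k)
  + (INR k * (INR k + 2 * alpha + 1)
     - 2 * INR j * (2 * INR j + 2 * alpha + 1)) * even_coef j k
  = 4 * INR j * (INR j + alpha) * even_coef (pred j) k.
Proof.
  destruct j as [|j].
  - destruct k; simpl; ring.
  - pose proof (even_coef_first_order j k) as H1.
    assert (H2 : (2 * INR j + 2 - INR k) * shift (shift (even_coef j)) k =
            (INR k - 1 - INR j) * shift (even_coef j) k).
    { destruct k as [|k]; [simpl; ring|].
      pose proof (even_coef_first_order j k) as H. cbn [shift]. rewrite S_INR. lra. }
    cbn [even_coef pred]. cbn [shift]. rewrite S_INR.
    set (x := even_coef j k) in *. set (y := shift (even_coef j) k) in *.
    set (z := shift (shift (even_coef j)) k) in *. clearbody x y z.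
    set (K := INR k) in *. set (J := INR j) in *. clearbody K J.
    (* The recurrence is a linear combination of the two first-order relations. *)
    assert (4 * (K + 2 * J + 2 * alpha + 3) * ((2 * J + 2 - K) * z)
            = 4 * (K + 2 * J + 2 * alpha + 3) * ((K - 1 - J) * y)) by (f_equal; exact H2).
    assert (4 * (K + J + 2 + alpha) * ((K - J) * x)
            = 4 * (K + J + 2 + alpha) * ((2 * J + 1 - K) * y)) by (f_equal; exact H1).
    lra.
Qed.

(** The derivative of [w^(j+1)] is [4(j+1)(1+2u) w^j]; this reduces odd coefficients to
    even ones. *)
Lemma odd_coef_derivative (j k : nat) :
  4 * (INR j + 1) * odd_coef j k = (INR k + 1) * even_coef (S j) (S k).
Proof.
  pose proof (even_coef_first_order j k) as H.
  unfold odd_coef. cbn [even_coef shift]. lra.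
Qed.

(** Differentiating the even case for [j+1] and [alpha-1] gives the same operator identity
    for [(1+2u) w^j], now with [n = 2j+1]. *)
Lemma odd_coef_recurrence (alpha : R) (j k : nat) :
  (INR k + 1) * (INR k + alpha + 1) * odd_coef j (S k)
  + (INR k * (INR k + 2 * alpha + 1)
     - (2 * INR j + 1) * (2 * INR j + 1 + 2 * alpha + 1)) * odd_coef j k
  = 4 * INR j * (INR j + alpha) * odd_coef (pred j) k.
Proof.
  pose proof (even_coef_recurrence (alpha - 1) (S j) (S k)) as H.
  pose proof (odd_coef_derivative j k) as H0.
  pose proof (odd_coef_derivative j (S k)) as H1.
  assert (H2 : 4 * INR j * odd_coef (pred j) k
               = (INR k + 1) * even_coef j (S k)).
  { destruct j as [|j]; [simpl; ring|].
    pose proof (odd_coef_derivative j k) as H2. cbn [pred]. rewrite S_INR in *. lra. }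
  assert (Hj : INR j + 1 <> 0) by (pose proof (pos_INR j); lra).
  cbn [pred] in H. rewrite !S_INR in H. rewrite !S_INR in H1.
  apply Rmult_eq_reg_l with (4 * (INR j + 1)); [|lra].
  set (a := even_coef (S j) (S (S k))) in *. set (b := even_coef (S j) (S k)) in *.
  set (c := even_coef j (S k)) in *. set (K := INR k) in *. set (J := INR j) in *.
  set (o0 := odd_coef j k) in *. set (o1 := odd_coef j (S k)) in *.
  set (o2 := odd_coef (pred j) k) in *. clearbody a b c K J o0 o1 o2.
  transitivity ((K + 1) * (K + alpha + 1) * (4 * (J + 1) * o1)
    + (K * (K + 2 * alpha + 1) - (2 * J + 1) * (2 * J + 1 + 2 * alpha + 1)) * (4 * (J + 1) * o0));
    [ring|]. rewrite H0, H1.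
  transitivity (4 * (J + 1) * (J + alpha) * (4 * J * o2)); [|ring]. rewrite H2.
  transitivity ((K + 1) * (4 * (J + 1) * (J + 1 + (alpha - 1)) * c)); [|ring].
  rewrite <- H. ring.
Qed.

(** * The quadratic transformation *)

(** Here [E j] stands for the coefficients of [t^e (t^2-1)^j].  The recurrence on [E] and the one
    on the coefficients of [P_m^(alpha,e-1/2)] make the sum on the right satisfy the
    recurrence of [P_(2m+e)^(alpha,alpha)]; then one inducts on [k]. *)
Lemma quadratic_coef (alpha : R) (e m : nat) (E : nat -> nat -> R) (k : nat) :
  -1 < alpha ->
  E 0%nat 0%nat = 1 -> (forall j, E (S j) 0%nat = 0) ->
  (forall j i,
     (INR i + 1) * (INR i + alpha + 1) * E j (S i)
     + (INR i * (INR i + 2 * alpha + 1)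
        - (2 * INR j + INR e) * (2 * INR j + INR e + 2 * alpha + 1)) * E j i
     = 4 * INR j * (INR j + alpha) * E (pred j) i) ->
  (k <= 2 * m + e)%nat ->
  jacobi_coef alpha (INR e - 1 / 2) m 0 * jacobi_coef alpha alpha (2 * m + e) k
  = jacobi_coef alpha alpha (2 * m + e) 0
    * sum_f_R0 (fun j => jacobi_coef alpha (INR e - 1 / 2) m j * E j k) m.
Proof.
  intros Ha E0 ES Hrec. set (b := jacobi_coef alpha (INR e - 1 / 2) m).
  set (n := (2 * m + e)%nat).
  assert (Hn : INR n = 2 * INR m + INR e)
    by (unfold n; rewrite plus_INR, mult_INR; simpl; ring).
  induction k as [|k IH]; intros Hk.
  - assert (Hs : forall i, sum_f_R0 (fun j => b j * E j 0%nat) i = b 0%nat).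
    { induction i as [|i IHi]; simpl; [rewrite E0; ring|].
      rewrite IHi, ES. ring. }
    rewrite Hs. ring.
  - specialize (IH ltac:(lia)).
    assert (Hkp : (INR k + 1) * (INR k + alpha + 1) <> 0).
    { pose proof (pos_INR k). apply Rmult_integral_contrapositive_currified; lra. }
    apply Rmult_eq_reg_l with ((INR k + 1) * (INR k + alpha + 1)); [|exact Hkp].
    transitivity (b 0%nat * ((INR k + 1) * (INR k + alpha + 1)
                    * jacobi_coef alpha alpha n (S k))); [ring|].
    rewrite jacobi_coef_succ by exact Hk.
    transitivity ((INR n - INR k) * (INR n + INR k + alpha + alpha + 1)
                  * (b 0%nat * jacobi_coef alpha alpha n k)); [ring|].
    rewrite IH.
    (* Applying the Jacobi operator to the first [i] terms leaves one boundary term, which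
       vanishes at [i = m]. *)
    assert (Htel : forall i, (i <= m)%nat ->
      (INR k + 1) * (INR k + alpha + 1) * sum_f_R0 (fun j => b j * E j (S k)) i
      - (INR n - INR k) * (INR n + INR k + alpha + alpha + 1)
        * sum_f_R0 (fun j => b j * E j k) i
      = - (4 * (INR m - INR i) * (INR m + INR i + alpha + (INR e - 1 / 2) + 1)
           * b i * E i k)).
    { induction i as [|i IHi]; intros Hi.
      - pose proof (Hrec 0%nat k) as H. simpl in H. simpl sum_f_R0. simpl (INR 0).
        rewrite Hn.
        transitivity (b 0%nat * ((INR k + 1) * (INR k + alpha + 1) * E 0%nat (S k)
          - (2 * INR m + INR e - INR k) * (2 * INR m + INR e + INR k + alpha + alpha + 1)
           * E 0%nat k)); [ring|].
        replace ((INR k + 1) * (INR k + alpha + 1) * E 0%nat (S k))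
          with (- ((INR k * (INR k + 2 * alpha + 1)
                    - INR e * (INR e + 2 * alpha + 1)) * E 0%nat k)) by lra.
        field.
      - rewrite !tech5. specialize (IHi ltac:(lia)).
        pose proof (Hrec (S i) k) as H. cbn [pred] in H.
        assert (Hb := jacobi_coef_succ alpha (INR e - 1 / 2) m i Hi). fold b in Hb.
        rewrite Hn in *. rewrite !S_INR in *.
        match type of IHi with ?l = _ => transitivity
         (l + b (S i) * ((INR k + 1) * (INR k + alpha + 1) * E (S i) (S k)
              - (2 * INR m + INR e - INR k) * (2 * INR m + INR e + INR k + alpha + alpha + 1)
                * E (S i) k)) end; [ring|].
        rewrite IHi.
        replace ((INR k + 1) * (INR k + alpha + 1) * E (S i) (S k))
          with (4 * (INR i + 1) * (INR i + 1 + alpha) * E i k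
                - (INR k * (INR k + 2 * alpha + 1) -
                   (2 * (INR i + 1) + INR e) * (2 * (INR i + 1) + INR e + 2 * alpha + 1))
                  * E (S i) k) by lra.
        transitivity (4 * E i k * ((INR i + 1) * (INR i + alpha + 1) * b (S i)
           - (INR m - INR i) * (INR m + INR i + alpha + (INR e - 1 / 2) + 1) * b i)
           - 4 * (INR m - (INR i + 1)) * (INR m + (INR i + 1) + alpha + (INR e - 1 / 2) + 1)
             * b (S i) * E (S i) k); [field|].
        rewrite Hb. ring. }
    specialize (Htel m (Nat.le_refl m)).
    rewrite Rminus_diag, Rmult_0_r, !Rmult_0_l, Ropp_0 in Htel.
    apply Rminus_diag_uniq_sym in Htel.
    set (S1 := sum_f_R0 (fun j => b j * E j (S k)) m) in *.
    set (S0 := sum_f_R0 (fun j => b j * E j k) m) in *.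
    transitivity (jacobi_coef alpha alpha n 0 *
       ((INR n - INR k) * (INR n + INR k + alpha + alpha + 1) * S0)); [ring|].
    rewrite Htel. ring.
Qed.

(** The constant of the quadratic transformation: the constant terms at [u = 0] are the
    values at [t = 1], where [2 t^2 - 1 = 1] too. *)
Definition leading_ratio (alpha : R) (e m : nat) : R :=
  jacobi_coef alpha alpha (2 * m + e) 0 / jacobi_coef alpha (INR e - 1 / 2) m 0.

Lemma leading_ratio_pos (alpha : R) (e m : nat) :
  -1 < alpha -> 0 < leading_ratio alpha e m.
Proof.
  intros Ha. apply Rdiv_lt_0_compat; apply jacobi_coef_0_pos, Ha.
Qed.

Lemma sum_exchange (f : nat -> nat -> R) (m n : nat) :
  sum_f_R0 (fun k => sum_f_R0 (fun j => f j k) m) n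
  = sum_f_R0 (fun j => sum_f_R0 (f j) n) m.
Proof.
  induction n as [|n IH]; simpl.
  - reflexivity.
  - rewrite IH, <- sum_plus. reflexivity.
Qed.

Lemma jacobi_quadratic (alpha : R) (e m : nat) (t : R) :
  -1 < alpha -> (e <= 1)%nat ->
  jacobi alpha alpha (2 * m + e) t
  = leading_ratio alpha e m * t ^ e * jacobi alpha (INR e - 1 / 2) m (2 * t ^ 2 - 1).
Proof.
  intros Ha He.
  pose proof (jacobi_coef_0_pos alpha (INR e - 1 / 2) m Ha) as Hb0.
  assert (HE : exists E : nat -> nat -> R,
     (forall k, (k <= 2 * m + e)%nat ->
       jacobi_coef alpha (INR e - 1 / 2) m 0 * jacobi_coef alpha alpha (2 * m + e) k
       = jacobi_coef alpha alpha (2 * m + e) 0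
         * sum_f_R0 (fun j => jacobi_coef alpha (INR e - 1 / 2) m j * E j k) m) /\
     (forall j, (j <= m)%nat ->
       sum_f_R0 (fun k => E j k * ((t - 1) / 2) ^ k) (2 * m + e)
       = t ^ e * (t ^ 2 - 1) ^ j)).
  { assert (e = 0 \/ e = 1)%nat as [-> | ->] by lia.
    - exists even_coef. split.
      + intros k. apply quadratic_coef; auto.
        * intros j. simpl. ring.
        * intros j i. simpl (INR 0). rewrite !Rplus_0_r. apply even_coef_recurrence.
      + intros j Hj. rewrite even_coef_sum by lia.
        replace (4 * ((t - 1) / 2) * (1 + (t - 1) / 2)) with (t ^ 2 - 1) by field.
        simpl (t ^ 0). ring.
    - exists odd_coef. split.
      + intros k. apply quadratic_coef; auto.
        * unfold odd_coef. simpl. ring.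
        * intros j. unfold odd_coef. simpl. ring.
        * intros j i. apply odd_coef_recurrence.
      + intros j Hj. rewrite odd_coef_sum by lia.
        replace (4 * ((t - 1) / 2) * (1 + (t - 1) / 2)) with (t ^ 2 - 1) by field.
        replace (1 + 2 * ((t - 1) / 2)) with (t ^ 1) by field. reflexivity. }
  destruct HE as [E [Hcoef Hsum]].
  unfold leading_ratio.
  apply Rmult_eq_reg_l with (jacobi_coef alpha (INR e - 1 / 2) m 0); [|lra].
  transitivity (jacobi_coef alpha alpha (2 * m + e) 0
    * (t ^ e * jacobi alpha (INR e - 1 / 2) m (2 * t ^ 2 - 1))); [|field; lra].
  unfold jacobi at 1. rewrite scal_sum.
  rewrite (sum_eq _ (fun k => sum_f_R0 (fun j =>
       jacobi_coef alpha (INR e - 1 / 2) m j * E j k * ((t - 1) / 2) ^ k) m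
       * jacobi_coef alpha alpha (2 * m + e) 0)).
  2:{ intros k Hk. fold (jacobi_coef alpha alpha (2 * m + e) k).
      transitivity (jacobi_coef alpha (INR e - 1 / 2) m 0 * jacobi_coef alpha alpha (2 * m + e) k
        * ((t - 1) / 2) ^ k); [ring|].
      rewrite Hcoef by exact Hk. rewrite <- scal_sum. ring. }
  rewrite <- scal_sum, sum_exchange. f_equal.
  unfold jacobi. rewrite scal_sum. apply sum_eq. intros j Hj.
  fold (jacobi_coef alpha (INR e - 1 / 2) m j).
  rewrite (sum_eq _ (fun k => E j k * ((t - 1) / 2) ^ k * jacobi_coef alpha (INR e - 1 / 2) m j))
    by (intros; ring).
  rewrite <- scal_sum, Hsum by exact Hj.
  replace ((2 * t ^ 2 - 1 - 1) / 2) with (t ^ 2 - 1) by field. ring.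
Qed.

(** * Convergence of the norm integral *)

Definition jacobi_integrand (alpha beta : R) (m : nat) (t : R) : R :=
  Rpower (1 - t) alpha * Rpower (1 + t) beta * jacobi alpha beta m t ^ 2.

Lemma jacobi_continuous (alpha beta : R) (m : nat) (t : R) :
  continuous (jacobi alpha beta m) t.
Proof.
  apply continuity_pt_filterlim. unfold jacobi.
  apply (continuity_pt_finite_SF
    (fun k t => pochhammer (INR m + alpha + beta + 1) k
       * pochhammer (alpha + INR k + 1) (m - k)
       / (INR (fact k) * INR (fact (m - k))) * ((t - 1) / 2) ^ k)).
  intros k _. apply derivable_continuous_pt, ex_derive_Reals_0. auto_derive. exact I.
Qed.

Lemma Rpower_affine_continuous (a b c t : R) :
  0 < a + b * t -> continuous (fun s => Rpower (a + b * s) c) t.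
Proof.
  intros H. apply (ex_derive_continuous (V := R_NormedModule)).
  unfold Rpower. auto_derive. exact H.
Qed.

Lemma right_factor_continuous (alpha beta : R) (m : nat) (t : R) :
  -1 < t -> continuous (fun s => Rpower (1 + s) beta * jacobi alpha beta m s ^ 2) t.
Proof.
  intros H.
  apply (continuous_mult (K := R_AbsRing)).
  - apply continuous_ext with (fun s => Rpower (1 + 1 * s) beta).
    { intros s. now rewrite Rmult_1_l. }
    apply Rpower_affine_continuous. lra.
  - apply continuous_ext with (fun s => jacobi alpha beta m s * jacobi alpha beta m s).
    { intros s. simpl. now rewrite Rmult_1_r. }
    apply (continuous_mult (K := R_AbsRing)); apply jacobi_continuous.
Qed.

Lemma jacobi_integrand_continuous (alpha beta : R) (m : nat) (t : R) :
  -1 < t < 1 -> continuous (jacobi_integrand alpha beta m) t.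
Proof.
  intros [H1 H2].
  assert (Heq : forall s, Rpower (1 + -1 * s) alpha
            * (Rpower (1 + s) beta * jacobi alpha beta m s ^ 2)
          = jacobi_integrand alpha beta m s).
  { intros s. unfold jacobi_integrand. replace (1 + -1 * s) with (1 - s) by ring. ring. }
  apply continuous_ext with (1 := Heq).
  apply (continuous_mult (K := R_AbsRing)).
  - apply Rpower_affine_continuous. lra.
  - apply right_factor_continuous. exact H1.
Qed.

Lemma jacobi_integrand_ge_0 (alpha beta : R) (m : nat) (t : R) :
  0 <= jacobi_integrand alpha beta m t.
Proof.
  unfold jacobi_integrand. apply Rmult_le_pos; [|apply pow2_ge_0].
  unfold Rpower. apply Rmult_le_pos; apply Rlt_le, exp_pos.
Qed.

Lemma jacobi_integrand_bound (alpha beta : R) (m : nat) :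
  exists M, 0 <= M /\ forall t, 0 <= t < 1 ->
    jacobi_integrand alpha beta m t <= M * Rpower (1 - t) alpha.
Proof.
  destruct (continuity_ab_maj
     (fun s => Rpower (1 + s) beta * jacobi alpha beta m s ^ 2) 0 1) as [x [Hx Hx1]];
    [lra| |].
  { intros c Hc. apply continuity_pt_filterlim, right_factor_continuous. lra. }
  exists (Rpower (1 + x) beta * jacobi alpha beta m x ^ 2). split.
  - apply Rmult_le_pos; [apply Rlt_le, exp_pos | apply pow2_ge_0].
  - intros t Ht. unfold jacobi_integrand. rewrite Rmult_assoc, Rmult_comm.
    apply Rmult_le_compat_r; [apply Rlt_le, exp_pos|]. apply Hx. lra.
Qed.

Lemma ex_RInt_jacobi_integrand (alpha beta : R) (m : nat) (a b : R) :
  -1 < a < 1 -> -1 < b < 1 -> ex_RInt (jacobi_integrand alpha beta m) a b.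
Proof.
  intros Ha Hb. apply (ex_RInt_continuous (V := R_CompleteNormedModule)).
  intros z Hz. apply jacobi_integrand_continuous. revert Hz.
  unfold Rmin, Rmax. destruct (Rle_dec a b); lra.
Qed.

Lemma is_RInt_endpoint_weight (alpha b : R) :
  -1 < alpha -> 0 <= b < 1 ->
  is_RInt (fun t => Rpower (1 - t) alpha) 0 b
    ((1 - Rpower (1 - b) (alpha + 1)) / (alpha + 1)).
Proof.
  intros Ha Hb.
  replace ((1 - Rpower (1 - b) (alpha + 1)) / (alpha + 1)) with
    (minus (- Rpower (1 - b) (alpha + 1) / (alpha + 1))
           (- Rpower (1 - 0) (alpha + 1) / (alpha + 1))).
  2:{ unfold minus, plus, opp; simpl. rewrite Rminus_0_r.
      replace (Rpower 1 (alpha + 1)) with 1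
        by (unfold Rpower; rewrite ln_1, Rmult_0_r, exp_0; reflexivity).
      field. lra. }
  apply (is_RInt_derive (V := R_CompleteNormedModule)
    (fun t => - Rpower (1 - t) (alpha + 1) / (alpha + 1))).
  - intros x Hx. rewrite Rmin_left, Rmax_right in Hx by lra.
    replace (Rpower (1 - x) alpha) with (Rpower (1 - x) (alpha + 1) * / (1 - x)).
    + unfold Rpower. auto_derive; [lra|]. unfold Rminus. field. lra.
    + rewrite Rpower_plus, Rpower_1 by lra. field. lra.
  - intros x Hx. rewrite Rmin_left, Rmax_right in Hx by lra.
    apply continuous_ext with (fun t => Rpower (1 + -1 * t) alpha).
    { intros t. replace (1 + -1 * t) with (1 - t) by ring. reflexivity. }
    apply Rpower_affine_continuous. lra.
Qed.

Lemma at_left_of_gt (x y : R) (P : R -> Prop) :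
  y < x -> (forall t, y < t < x -> P t) -> at_left x P.
Proof.
  intros Hxy H. exists (mkposreal (x - y) (proj2 (Rlt_0_minus _ _) Hxy)).
  intros t Ht Htx. apply H. apply Rabs_def2 in Ht. simpl in Ht.
  unfold minus, plus, opp in Ht; simpl in Ht. lra.
Qed.

Lemma at_right_of_lt (x y : R) (P : R -> Prop) :
  x < y -> (forall t, x < t < y -> P t) -> at_right x P.
Proof.
  intros Hxy H. exists (mkposreal (y - x) (proj2 (Rlt_0_minus _ _) Hxy)).
  intros t Ht Htx. apply H. apply Rabs_def2 in Ht. simpl in Ht.
  unfold minus, plus, opp in Ht; simpl in Ht. lra.
Qed.

Lemma monotone_bounded_limit (f : R -> R) (a b C : R) :
  a < b ->
  (forall s t, a <= s <= t -> t < b -> f s <= f t) ->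
  (forall t, a <= t < b -> f t <= C) ->
  exists L, filterlim f (at_left b) (locally L).
Proof.
  intros Hab Hmono Hbound.
  destruct (completeness (fun y => exists t, a <= t < b /\ y = f t)) as [L [HL1 HL2]].
  - exists C. intros y [t [Ht ->]]. auto.
  - exists (f a), a. split; [lra|reflexivity].
  - exists L. apply filterlim_locally. intros eps.
    assert (exists t0, a <= t0 < b /\ L - eps < f t0) as [t0 [Ht0 Hf0]].
    { apply NNPP. intros Hno.
      assert (L <= L - eps); [|destruct eps; simpl in *; lra].
      apply HL2. intros y [t [Ht ->]]. apply Rnot_lt_le. intros Hlt.
      apply Hno. now exists t. }
    apply at_left_of_gt with t0; [lra|]. intros t Ht.
    assert (f t <= L) by (apply HL1; exists t; split; [lra|reflexivity]).
    assert (f t0 <= f t) by (apply Hmono; lra).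
    change (Rabs (f t - L) < eps). apply Rabs_def1; destruct eps; simpl in *; lra.
Qed.

(** The primitive increases because the integrand is nonnegative, and it is bounded because
    [(1-t)^alpha] has integral [1/(alpha+1)] over [[0,1)]. *)
Lemma jacobi_primitive_limit (alpha beta : R) (m : nat) :
  -1 < alpha ->
  exists L, filterlim (RInt (jacobi_integrand alpha beta m) 0) (at_left 1) (locally L).
Proof.
  intros Ha. destruct (jacobi_integrand_bound alpha beta m) as [M [HM HF]].
  apply monotone_bounded_limit with 0 (M / (alpha + 1)); [lra| |].
  - intros s t Hst Ht.
    rewrite <- (RInt_Chasles (jacobi_integrand alpha beta m) 0 s t)
      by (apply ex_RInt_jacobi_integrand; lra).
    assert (0 <= RInt (jacobi_integrand alpha beta m) s t).
    { apply RInt_ge_0; [lra|apply ex_RInt_jacobi_integrand; lra|].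
      intros; apply jacobi_integrand_ge_0. }
    unfold plus; simpl. lra.
  - intros t Ht.
    pose proof (is_RInt_scal _ _ _ M _ (is_RInt_endpoint_weight alpha t Ha Ht)) as Hw.
    change (is_RInt (fun x => M * Rpower (1 - x) alpha) 0 t
      (M * ((1 - Rpower (1 - t) (alpha + 1)) / (alpha + 1)))) in Hw.
    apply Rle_trans with (M * ((1 - Rpower (1 - t) (alpha + 1)) / (alpha + 1))).
    + rewrite <- (is_RInt_unique _ _ _ _ Hw).
      apply RInt_le; [lra|apply ex_RInt_jacobi_integrand; lra|eexists; exact Hw|].
      intros x Hx. apply HF. lra.
    + unfold Rdiv. rewrite <- !Rmult_assoc.
      apply Rmult_le_compat_r; [apply Rlt_le, Rinv_0_lt_compat; lra|].
      rewrite <- (Rmult_1_r M) at 2. apply Rmult_le_compat_l; [exact HM|].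
      pose proof (exp_pos ((alpha + 1) * ln (1 - t))). unfold Rpower. lra.
Qed.

(** * The two norm integrals *)

(** The fundamental theorem of calculus for an improper integral over an open interval, with
    hypotheses on the inside of the interval only. *)
Lemma RInt_gen_primitive (f F : R -> R) (la lb : R) :
  (forall x, -1 < x < 1 -> is_derive F x (f x)) ->
  (forall x, -1 < x < 1 -> continuous f x) ->
  filterlim F (at_right (-1)) (locally la) ->
  filterlim F (at_left 1) (locally lb) ->
  RInt_gen f (at_right (-1)) (at_left 1) = lb - la.
Proof.
  intros HF Hf Hla Hlb. apply is_RInt_gen_unique.
  assert (Hin : filter_prod (at_right (-1)) (at_left 1) (fun ab : R * R =>
     forall x, Rmin (fst ab) (snd ab) <= x <= Rmax (fst ab) (snd ab) -> -1 < x < 1)).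
  { apply Filter_prod with (fun a => -1 < a < 1) (fun b => -1 < b < 1).
    - apply at_right_of_lt with 1; [lra|auto].
    - apply at_left_of_gt with (-1); [lra|auto].
    - intros a b Ha Hb x. simpl. unfold Rmin, Rmax. destruct (Rle_dec a b); lra. }
  apply is_RInt_gen_ext with (Derive F).
  { apply filter_imp with (2 := Hin). intros ab H x Hx.
    apply is_derive_unique, HF, H. lra. }
  apply is_RInt_gen_Derive; try assumption.
  - apply filter_imp with (2 := Hin). intros ab H x Hx.
    eexists. apply HF, H, Hx.
  - apply filter_imp with (2 := Hin). intros ab H x Hx.
    specialize (H x Hx). apply continuous_ext_loc with f; [|auto].
    assert (Hl : locally x (fun y => -1 < y < 1)).
    { apply (open_and (fun y => -1 < y) (fun y => y < 1));
        [apply open_gt|apply open_lt|exact H]. }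
    apply filter_imp with (2 := Hl). intros y Hy. symmetry.
    apply is_derive_unique, HF, Hy.
Qed.

Lemma jacobi_primitive_derive (alpha beta : R) (m : nat) (t : R) :
  -1 < t < 1 ->
  is_derive (RInt (jacobi_integrand alpha beta m) 0) t (jacobi_integrand alpha beta m t).
Proof.
  intros Ht. apply (is_derive_RInt (V := R_CompleteNormedModule) _ _ 0).
  - assert (Hl : locally t (fun y => -1 < y < 1)).
    { apply (open_and (fun y => -1 < y) (fun y => y < 1));
        [apply open_gt|apply open_lt|exact Ht]. }
    apply filter_imp with (2 := Hl). intros y Hy.
    apply (RInt_correct (V := R_CompleteNormedModule)), ex_RInt_jacobi_integrand; lra.
  - apply jacobi_integrand_continuous, Ht.
Qed.

Lemma jacobi_integrand_even (alpha : R) (e m : nat) (t : R) :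
  -1 < alpha -> (e <= 1)%nat ->
  jacobi_integrand alpha alpha (2 * m + e) (- t) = jacobi_integrand alpha alpha (2 * m + e) t.
Proof.
  intros Ha He. unfold jacobi_integrand. rewrite !jacobi_quadratic by assumption.
  replace (1 - - t) with (1 + t) by ring. replace (1 + - t) with (1 - t) by ring.
  replace (2 * (- t) ^ 2 - 1) with (2 * t ^ 2 - 1) by ring.
  assert (e = 0 \/ e = 1)%nat as [-> | ->] by lia; ring.
Qed.

(** The primitive [Phi] of an even function is odd, so its limit at [-1] is [-L]. *)
Lemma jacobi_norm_symmetric (alpha : R) (e m : nat) (L : R) :
  -1 < alpha -> (e <= 1)%nat ->
  filterlim (RInt (jacobi_integrand alpha alpha (2 * m + e)) 0) (at_left 1) (locally L) ->
  jacobi_norm alpha alpha (2 * m + e) = 2 * L.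
Proof.
  intros Ha He HL. replace (2 * L) with (L - - L) by ring.
  set (F := jacobi_integrand alpha alpha (2 * m + e)) in *.
  unfold jacobi_norm. fold (jacobi_integrand alpha alpha (2 * m + e)). fold F.
  apply RInt_gen_primitive with (RInt F 0).
  - intros x Hx. apply jacobi_primitive_derive, Hx.
  - intros x Hx. apply jacobi_integrand_continuous, Hx.
  - assert (Hodd : forall t, -1 < t < 1 -> RInt F 0 t = - RInt F 0 (- t)).
    { intros t Ht. apply is_RInt_unique.
      replace (- RInt F 0 (- t)) with (opp (RInt F (- 0) (- t))) by (now rewrite Ropp_0).
      apply is_RInt_ext with (fun y => opp (opp (F (- y)))).
      { intros y _. rewrite opp_opp. apply jacobi_integrand_even; assumption. }
      apply (is_RInt_opp (V := R_NormedModule)).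
      apply (is_RInt_comp_opp (V := R_NormedModule)).
      apply (RInt_correct (V := R_CompleteNormedModule)).
      apply ex_RInt_jacobi_integrand; lra. }
    apply filterlim_ext_loc with (fun t => opp (RInt F 0 (- t))).
    { apply at_right_of_lt with 1; [lra|]. intros t Ht. symmetry. apply Hodd, Ht. }
    apply filterlim_comp with (locally L); [|apply (filterlim_opp (V := R_NormedModule) L)].
    apply filterlim_comp with (at_left 1); [|exact HL].
    pose proof (filterlim_Ropp_right (-1)) as Hopp.
    replace (- -1) with 1 in Hopp by ring. exact Hopp.
  - exact HL.
Qed.

(** The factor [4 t] is [ds/dt].  From [1 - s = 2 (1-t)(1+t)] and [1 + s = 2 t^2] the two
    weights contribute [2^(alpha + e - 1/2)] and [t^(2e-1)]. *)
Lemma jacobi_integrand_substitution (alpha : R) (e m : nat) (s t : R) :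
  -1 < alpha -> (e <= 1)%nat -> 0 < t < 1 -> s = 2 * t ^ 2 - 1 ->
  4 * t * jacobi_integrand alpha (INR e - 1 / 2) m s
  * leading_ratio alpha e m ^ 2
  = Rpower 2 (alpha + INR e + 3 / 2) * jacobi_integrand alpha alpha (2 * m + e) t.
Proof.
  intros Ha He Ht ->. unfold jacobi_integrand.
  rewrite jacobi_quadratic by assumption.
  replace (1 - (2 * t ^ 2 - 1)) with (2 * ((1 - t) * (1 + t))) by ring.
  replace (1 + (2 * t ^ 2 - 1)) with (2 * t ^ 2) by ring.
  assert (0 < t ^ 2) by (apply pow_lt; lra).
  rewrite <- !Rpower_mult_distr by (try apply Rmult_lt_0_compat; lra).
  replace (Rpower (t ^ 2) (INR e - 1 / 2)) with (t ^ (2 * e) / t).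
  2:{ rewrite <- !Rpower_pow by lra. rewrite Rpower_mult.
      replace (INR 2 * (INR e - 1 / 2)) with (INR (2 * e) + - (1))
        by (rewrite mult_INR; simpl; field).
      rewrite Rpower_plus, Rpower_Ropp, Rpower_1 by lra. reflexivity. }
  replace (alpha + INR e + 3 / 2) with (alpha + (INR e - 1 / 2) + INR 2)
    by (simpl; field).
  rewrite !Rpower_plus, Rpower_pow, Nat.mul_comm, pow_mult by lra.
  set (q := jacobi _ _ _ _). field. lra.
Qed.

(** Only the endpoint [1] is singular in the variable [t = sqrt((1+s)/2)]: the endpoint
    [s = -1] corresponds to [t = 0], where the symmetric integrand is continuous. *)
Lemma jacobi_norm_half (alpha : R) (e m : nat) (L : R) :
  -1 < alpha -> (e <= 1)%nat ->
  filterlim (RInt (jacobi_integrand alpha alpha (2 * m + e)) 0) (at_left 1) (locally L) ->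
  jacobi_norm alpha (INR e - 1 / 2) m
  = Rpower 2 (alpha + INR e + 3 / 2) / leading_ratio alpha e m ^ 2 * L.
Proof.
  intros Ha He HL. set (F := jacobi_integrand alpha alpha (2 * m + e)) in *.
  pose proof (leading_ratio_pos alpha e m Ha) as Hc.
  set (K := Rpower 2 (alpha + INR e + 3 / 2) / leading_ratio alpha e m ^ 2).
  replace (K * L) with (K * L - K * RInt F 0 (sqrt ((1 + -1) / 2))).
  2:{ replace ((1 + -1) / 2) with 0 by field. rewrite sqrt_0, RInt_point.
      unfold zero; simpl. ring. }
  unfold jacobi_norm. fold (jacobi_integrand alpha (INR e - 1 / 2) m).
  assert (Hsqrt : forall s, -1 < s < 1 -> 0 < sqrt ((1 + s) / 2) < 1).
  { intros s Hs. split; [apply sqrt_lt_R0; lra|].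
    apply Rlt_le_trans with (sqrt 1); [apply sqrt_lt_1; lra | rewrite sqrt_1; lra]. }
  assert (Hscal : forall (G : (R -> Prop) -> Prop) (f : R -> R) (l : R), Filter G ->
     filterlim f G (locally l) -> filterlim (fun s => K * f s) G (locally (K * l))).
  { intros G f l HG Hfl. apply filterlim_comp with (locally l); [exact Hfl|].
    apply (filterlim_scal_r (V := R_NormedModule) K l). }
  assert (Hroot : forall x, filterlim (fun s => sqrt ((1 + s) / 2)) (locally x)
                      (locally (sqrt ((1 + x) / 2)))).
  { intros x. apply (continuous_comp (fun s => (1 + s) / 2) sqrt).
    - apply (ex_derive_continuous (V := R_NormedModule)). auto_derive. exact I.
    - apply continuous_sqrt. }
  apply RInt_gen_primitive with (fun s => K * RInt F 0 (sqrt ((1 + s) / 2))).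
  - intros s Hs. specialize (Hsqrt s Hs).
    set (t := sqrt ((1 + s) / 2)) in *.
    assert (Ht2 : s = 2 * t ^ 2 - 1).
    { unfold t. rewrite pow2_sqrt by lra. field. }
    replace (jacobi_integrand alpha (INR e - 1 / 2) m s)
      with (K * (/ (4 * t) * F t)).
    2:{ unfold K. apply Rmult_eq_reg_l with (4 * t * leading_ratio alpha e m ^ 2);
          [|apply Rmult_integral_contrapositive_currified; [lra|apply pow_nonzero; lra]].
        transitivity (Rpower 2 (alpha + INR e + 3 / 2) * F t); [field; split; lra|].
        unfold F. rewrite <- (jacobi_integrand_substitution alpha e m s t Ha He Hsqrt Ht2).
        ring. }
    apply is_derive_scal.
    apply (is_derive_comp (RInt F 0) (fun s => sqrt ((1 + s) / 2))).
    + apply jacobi_primitive_derive. fold t. lra.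
    + auto_derive; [lra|]. replace ((1 + s) * / 2) with ((1 + s) / 2) by reflexivity.
      fold t. field. lra.
  - intros s Hs. apply jacobi_integrand_continuous, Hs.
  - apply (filterlim_filter_le_1 (F := locally (-1)) _ (filter_le_within _)).
    apply Hscal; [typeclasses eauto|].
    apply filterlim_comp with (locally (sqrt ((1 + -1) / 2))); [apply Hroot|].
    apply (ex_derive_continuous (V := R_NormedModule)). eexists.
    apply jacobi_primitive_derive. replace ((1 + -1) / 2) with 0 by field.
    rewrite sqrt_0. lra.
  - apply Hscal; [typeclasses eauto|].
    apply filterlim_comp with (at_left 1); [|exact HL].
    intros P HP. unfold filtermap.
    assert (Hin : at_left 1 (fun s => -1 < s < 1)) by (apply at_left_of_gt with (-1); [lra|auto]).
    assert (Hr : at_left 1 (fun s => sqrt ((1 + s) / 2) < 1 -> P (sqrt ((1 + s) / 2)))).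
    { apply (filter_le_within (F := locally 1)). apply (Hroot 1 (fun t => t < 1 -> P t)).
      replace ((1 + 1) / 2) with 1 by field. rewrite sqrt_1. exact HP. }
    apply filter_imp with (2 := filter_and _ _ Hin Hr). intros s [Hs HPs].
    apply HPs, Hsqrt, Hs.
Qed.

(** Both norms are multiples of the same limit [L], with ratio [(r / c)^2]. *)
Lemma sqrt_jacobi_norm (alpha : R) (e m : nat) :
  -1 < alpha -> (e <= 1)%nat ->
  leading_ratio alpha e m / sqrt (jacobi_norm alpha alpha (2 * m + e))
  = Rpower 2 ((2 * alpha + 2 * INR e + 1) / 4)
    / sqrt (jacobi_norm alpha (INR e - 1 / 2) m).
Proof.
  intros Ha He.
  pose proof (leading_ratio_pos alpha e m Ha) as Hc.
  destruct (jacobi_primitive_limit alpha alpha (2 * m + e) Ha) as [L HL].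
  pose proof (jacobi_norm_symmetric alpha e m L Ha He HL) as Hs.
  pose proof (jacobi_norm_half alpha e m L Ha He HL) as Hh.
  set (c := leading_ratio alpha e m) in *.
  set (r := Rpower 2 ((2 * alpha + 2 * INR e + 1) / 4)).
  assert (Hr : 0 < r) by apply exp_pos.
  assert (Hh' : jacobi_norm alpha (INR e - 1 / 2) m
               = (r / c) ^ 2 * jacobi_norm alpha alpha (2 * m + e)).
  { rewrite Hh, Hs.
    replace (Rpower 2 (alpha + INR e + 3 / 2)) with (2 * r ^ 2).
    2:{ unfold r. rewrite <- Rpower_pow, Rpower_mult by apply exp_pos.
        rewrite <- (Rpower_1 2) at 1 by lra. rewrite <- Rpower_plus.
        f_equal. simpl. field. }
    field. lra. }
  rewrite Hh', sqrt_mult_alt by apply pow2_ge_0.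
  rewrite sqrt_pow2 by (apply Rlt_le, Rdiv_lt_0_compat; assumption).
  set (g := sqrt (jacobi_norm alpha alpha (2 * m + e))).
  transitivity (r * (/ (r / c) * / g)).
  - unfold Rdiv at 1. generalize (/ g). intros h. field. lra.
  - rewrite <- Rinv_mult. reflexivity.
Qed.

(** * Comparison of the two systems *)

Lemma tanh_bounds (x : R) : -1 < tanh x < 1.
Proof.
  unfold tanh, sinh, cosh. pose proof (exp_pos x). pose proof (exp_pos (- x)).
  split.
  - apply Rlt_div_r; lra.
  - apply Rlt_div_l; lra.
Qed.

Lemma cosh_pos (x : R) : 0 < cosh x.
Proof.
  unfold cosh. pose proof (exp_pos x). pose proof (exp_pos (- x)). lra.
Qed.

Lemma one_minus_tanh_sqr (x : R) : 1 - tanh x ^ 2 = / cosh x ^ 2.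
Proof.
  pose proof (cosh_pos x) as Hc. unfold tanh.
  assert (H : cosh x ^ 2 - sinh x ^ 2 = 1).
  { unfold cosh, sinh.
    transitivity (exp x * exp (- x)); [field|].
    rewrite <- exp_plus, Rplus_opp_r. apply exp_0. }
  transitivity ((cosh x ^ 2 - sinh x ^ 2) / cosh x ^ 2); [field; lra|].
  rewrite H. field. lra.
Qed.

Lemma tanh_weight (alpha x : R) :
  Rpower (1 - tanh x) ((alpha + 1) / 2) * Rpower (1 + tanh x) ((alpha + 1) / 2)
  = / Rpower (cosh x) (1 + alpha).
Proof.
  pose proof (tanh_bounds x). pose proof (cosh_pos x).
  rewrite Rpower_mult_distr by lra.
  replace ((1 - tanh x) * (1 + tanh x)) with (1 - tanh x ^ 2) by ring.
  rewrite one_minus_tanh_sqr, <- Rpower_pow, <- Rpower_Ropp, Rpower_mult by assumption.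
  rewrite <- Rpower_Ropp. f_equal. simpl. field.
Qed.

(** For [e = 0] and [e = 1] the right-hand side is the even, respectively odd, half-range
    function, up to writing [tanh x] as [sinh x / cosh x]. *)
Lemma full_range_quadratic (alpha : R) (e m : nat) (x : R) :
  -1 < alpha -> (e <= 1)%nat ->
  full_range alpha alpha (2 * m + e) x
  = (-1) ^ e * (Rpower 2 ((2 * alpha + 2 * INR e + 1) / 4)
                / sqrt (jacobi_norm alpha (INR e - 1 / 2) m))
    * (tanh x ^ e / Rpower (cosh x) (1 + alpha))
    * jacobi alpha (INR e - 1 / 2) m (1 - 2 / cosh x ^ 2).
Proof.
  intros Ha He. unfold full_range.
  rewrite <- sqrt_jacobi_norm by assumption.
  rewrite jacobi_quadratic by assumption.
  rewrite pow_add, pow_1_even.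
  replace (2 * tanh x ^ 2 - 1) with (1 - 2 / cosh x ^ 2).
  2:{ unfold Rdiv. rewrite <- one_minus_tanh_sqr. ring. }
  unfold Rdiv. rewrite <- tanh_weight. unfold Rdiv. ring.
Qed.

Theorem mainTheorem3 (alpha : R) (halpha : -1 < alpha) (m : nat) (x : R) :
  half_range alpha m x = full_range alpha alpha m x.
Proof.
  unfold half_range. destruct (Nat.even m) eqn:Hm.
  - apply Nat.even_spec in Hm as [k ->]. rewrite Nat.div2_double.
    rewrite <- (Nat.add_0_r (2 * k)), full_range_quadratic by (assumption || lia).
    unfold half_range_even. simpl (INR 0).
    replace (0 - 1 / 2) with (- (1 / 2)) by field.
    replace (2 * alpha + 2 * 0 + 1) with (2 * alpha + 1) by ring.
    simpl ((-1) ^ 0). simpl (tanh x ^ 0). ring.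
  - assert (Ho : Nat.odd m = true) by (unfold Nat.odd; now rewrite Hm).
    apply Nat.odd_spec in Ho as [k ->].
    replace (Nat.div2 (2 * k + 1)) with k
      by (rewrite Nat.add_1_r, Nat.div2_succ_double; reflexivity).
    rewrite full_range_quadratic by (assumption || lia).
    unfold half_range_odd. simpl (INR 1).
    replace (1 - 1 / 2) with (1 / 2) by field.
    replace (2 * alpha + 2 * 1 + 1) with (2 * alpha + 3) by ring.
    replace (2 + alpha) with (1 + alpha + 1) by ring.
    pose proof (cosh_pos x).
    rewrite Rpower_plus, Rpower_1 by assumption.
    replace (tanh x ^ 1) with (sinh x / cosh x) by (unfold tanh; ring).
    unfold Rdiv. rewrite Rinv_mult. ring.
Qed.
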